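(* Let $(R,f,g)$ be a commutative Krasner $(m,n)$-hyperring with nonzero scalar identity $1$, and let $P$ be a proper hyperideal of $R$. For $r\in R$ put $P_r=\{a\in R : g(r,a,1^{(n-2)})\in P\}$ and $A_r=\{a\in R : g(r,a,1^{(n-2)})=0\}$. Then $P$ is an $n$-ary $wsq$-primary hyperideal of $R$ if and only if for every $r\in R$ we have $\langle r\rangle\subseteq P_r$ or $P_r\subseteq \mathbf{r}^{(m,n)}(P)$ or $P_r\subseteq A_r$.
   Context: Notation: $m,n\ge 2$; $a_i^j$ denotes the sequence $a_i,a_{i+1},\dots,a_j$ (empty if $j<i$), and $a^{(k)}$ denotes $a$ repeated $k$ times. An $m$-ary hyperoperation $f$ on $R$ assigns to every $m$-tuple a nonempty subset of $R$ (a singleton is identified with its element). For nonempty subsets, $f(A_1^m)=\bigcup\{f(a_1^m): a_i\in A_i\}$ and $g(A_1^n)=\{g(a_1^n): a_i\in A_i\}$; an element $x$ in an argument stands for $\{x\}$. A canonical $m$-ary hypergroup $(R,f)$: $f$ is associative and commutative; there is a unique $0\in R$ with $f(x,0^{(m-1)})=\{x\}$ for all $x$; each $x$ has a unique $-x$ with $0\in f(x,-x,0^{(m-2)})$; and $x\in f(x_1^m)$ implies $x_i\in f(x,-x_1,\dots,-x_{i-1},-x_{i+1},\dots,-x_m)$ for each $i$. A Krasner $(m,n)$-hyperring $(R,f,g)$: $(R,f)$ is a canonical $m$-ary hypergroup, $g:R^n\to R$ is associative ($n$-ary semigroup), $g$ is distributive over $f$ in each argument, i.e. $g(a_1^{i-1},f(x_1^m),a_{i+1}^n)=f(g(a_1^{i-1},x_1,a_{i+1}^n),\dots,g(a_1^{i-1},x_m,a_{i+1}^n))$,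 and $0$ is absorbing for $g$. Commutative means $g$ is symmetric in its arguments; a scalar identity $1$ satisfies $g(x,1^{(n-1)})=x$ for all $x$. A hyperideal of $R$ is a nonempty $I\subseteq R$ that is an $m$-ary subhypergroup of $(R,f)$ (closed under $f$ and under $x\mapsto -x$) with $g(a_1^{i-1},I,a_{i+1}^n)\subseteq I$ for all $a_1^n\in R$ and all $i$. For $x\in R$, $\langle x\rangle=\{g(r,x,1^{(n-2)}): r\in R\}$. A proper hyperideal $Q$ is ($n$-ary) prime if $g(a_1^n)\in Q$ with $a_1^n\in R$ implies $a_i\in Q$ for some $i$. The radical $\mathbf{r}^{(m,n)}(I)$ of a hyperideal $I$ is the intersection of all prime hyperideals containing $I$ (equal to $R$ if there are none). A proper hyperideal $P$ is $n$-ary $wsq$-primary (weakly strongly quasi-primary) if for all $r_1^n\in R$, $0\ne g(r_1^n)\in P$ implies $g(r_i^{(2)},1^{(n-2)})\in P$ or $g(r_1^{i-1},1,r_{i+1}^n)\in \mathbf{r}^{(m,n)}(P)$ for some $1\le i\le n$.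
   Formalization: In the definition of n-ary wsq-primary, the index i in ''for some 1≤i≤n'' is fixed before r_1^n (one i serves all tuples) rather than depending on r_1^n; with i depending on the tuple the equivalence fails, e.g. P=(X^3,XY) in k[X,Y]. *)

(* Defs.v *)
(* An m-tuple of elements of R is a function 'I_m -> R, so the indices
   1, ..., m of the mathematical notation become 0, ..., m - 1. *)
From mathcomp Require Import all_boot perm.
From mathcomp Require Import boolp classical_sets.

Set Implicit Arguments.
Unset Strict Implicit.
Unset Printing Implicit Defensive.

Local Open Scope classical_set_scope.

(* The n-tuple that starts with the entries of s and goes on with z's:
   pad 1 [:: x; y] is (x, y, 1^(n-2)). *)
Definition pad (R : Type) (n : nat) (z : R) (s : seq R) : 'I_n -> R :=
  fun k => nth z s k.

Definition hyperlift (R : Type) (m : nat) (f : ('I_m -> R) -> set R)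
    (A : 'I_m -> set R) : set R :=
  [set x | exists2 a : 'I_m -> R, (forall i, A i (a i)) & f a x].

(* nested a i c is the n-tuple (a_0, ..., a_(i-1), c, a_(i+n), ..., a_(2n-2)),
   in which c stands for an operation applied to a_i, ..., a_(i+n-1).
   Only the first 2n - 1 terms of the sequence a are ever used. *)
Definition nested (T : Type) (n : nat) (a : nat -> T) (i : 'I_n) (c : T) :
    'I_n -> T :=
  fun k => if k < i then a k else if k == i then c else a (k + n).-1.

Definition window (T : Type) (n : nat) (a : nat -> T) (i : nat) : 'I_n -> T :=
  fun k => a (i + k).

Definition hyper_associative (R : Type) (m : nat)
    (f : ('I_m -> R) -> set R) : Prop :=
  forall (a : nat -> R) (i j : 'I_m),
    hyperlift f (nested (fun k => [set a k]) i (f (window a i))) =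
    hyperlift f (nested (fun k => [set a k]) j (f (window a j))).

Definition nary_associative (R : Type) (n : nat) (g : ('I_n -> R) -> R) : Prop :=
  forall (a : nat -> R) (i j : 'I_n),
    g (nested a i (g (window a i))) = g (nested a j (g (window a j))).

Definition nary_commutative (R S : Type) (n : nat) (h : ('I_n -> R) -> S) : Prop :=
  forall (s : 'S_n) (a : 'I_n -> R), h (fun k => a (s k)) = h a.

(* In reversibility the arguments are x, then the - a_j with j != i in
   increasing order of j; ord_pred k has value k - 1 when 0 < k. *)
Record canonical_hypergroup (R : Type) (m : nat) (f : ('I_m -> R) -> set R)
    (zero : R) (opp : R -> R) : Prop := CanonicalHypergroup {
  hadd_nonempty : forall a, f a !=set0;
  hadd_assoc : hyper_associative f;
  hadd_comm : nary_commutative f;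
  hadd_zero : forall x, f (pad zero [:: x]) = [set x];
  hadd_zero_unique :
    forall e, (forall x, f (pad e [:: x]) = [set x]) -> e = zero;
  hadd_opp : forall x, f (pad zero [:: x; opp x]) zero;
  hadd_opp_unique : forall x y, f (pad zero [:: x; y]) zero -> y = opp x;
  hadd_reversible : forall (x : R) (a : 'I_m -> R) (i : 'I_m), f a x ->
    f (fun k => if k == 0 :> nat then x
                else if k <= i then opp (a (ord_pred k)) else opp (a k)) (a i)
}.

Record krasner_hyperring (m n : nat) : Type := KrasnerHyperring {
  carrier :> Type;
  hadd : ('I_m -> carrier) -> set carrier;
  gmul : ('I_n -> carrier) -> carrier;
  kzero : carrier;
  kopp : carrier -> carrier;
  hadd_canonical : canonical_hypergroup hadd kzero kopp;
  gmul_assoc : nary_associative gmul;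
  gmul_distr : forall (i : 'I_n) (a : 'I_n -> carrier) (x : 'I_m -> carrier),
    [set gmul [eta a with i |-> y] | y in hadd x] =
    hadd (fun j => gmul [eta a with i |-> x j]);
  gmul_zero : forall (a : 'I_n -> carrier) (i : 'I_n),
    a i = kzero -> gmul a = kzero
}.

Arguments hadd {m n k} _.
Arguments gmul {m n k} _.
Arguments kzero {m n k}.
Arguments kopp {m n k} _.

Section Hyperideals.
Variables (m n : nat) (R : krasner_hyperring m n).
Implicit Types (I P Q : set R) (x r one : R).

Definition commutative_hyperring : Prop :=
  nary_commutative (@gmul m n R).

Definition scalar_identity one : Prop :=
  forall x, gmul (pad one [:: x]) = x.

Record hyperideal I : Prop := Hyperideal {
  hyperideal_nonempty : I !=set0;
  hyperideal_hadd : forall a : 'I_m -> R, (forall j, I (a j)) -> hadd a `<=` I;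
  hyperideal_opp : forall x, I x -> I (kopp x);
  hyperideal_gmul : forall (a : 'I_n -> R) (i : 'I_n), I (a i) -> I (gmul a)
}.

Definition proper_hyperideal I : Prop := hyperideal I /\ I <> setT.

Definition prime_hyperideal Q : Prop :=
  proper_hyperideal Q /\
  forall a : 'I_n -> R, Q (gmul a) -> exists i, Q (a i).

(* An intersection over an empty family is setT. *)
Definition radical I : set R :=
  \bigcap_(Q in [set Q | prime_hyperideal Q /\ I `<=` Q]) Q.

Definition principal one x : set R :=
  [set gmul (pad one [:: r; x]) | r in [set: R]].

(* "For some i" is read with i fixed before the tuple r. As gmul is commutative
   in all uses, the condition does not depend on the chosen i. For m = n = 2 it
   says that 0 <> a b \in P implies a ^ 2 \in P or b \in radical P. If i could
   depend on r, a \in radical P would also be allowed: in k[X, Y] the ideal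
   P = (X ^ 3, X Y) would then qualify, as its radical (X) is prime, although
   X Y \in P with X ^ 2 \notin P and Y \notin (X). *)
Definition wsq_primary one P : Prop :=
  proper_hyperideal P /\
  exists i : 'I_n, forall r : 'I_n -> R,
    gmul r <> kzero -> P (gmul r) ->
    P (gmul (pad one [:: r i; r i])) \/
    radical P (gmul [eta r with i |-> one]).

Definition residual one P r : set R :=
  [set a | P (gmul (pad one [:: r; a]))].

Definition annihilator one r : set R :=
  [set a | gmul (pad one [:: r; a]) = kzero].

End Hyperideals.

Arguments commutative_hyperring {m n} R.

(* Main.v *)
Require Import Defs.
From mathcomp Require Import all_boot.
From mathcomp Require Import perm.
From mathcomp Require Import boolp classical_sets.

Set Implicit Arguments.
Unset Strict Implicit.
Unset Printing Implicit Defensive.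

Local Open Scope classical_set_scope.

(** Write [r . a] for [g(r, a, 1^(n-2))]. Associativity, commutativity and the
    scalar identity turn [.] into a commutative monoid law from which [g] is
    recovered one factor at a time: [g(r_1^n) = r_i . g(r_1^(i-1), 1, r_(i+1)^n)]
    ([gmul_split]). The wsq-primary condition is therefore a statement about
    [.] alone: if [0 <> r . a \in P], then [r . r \in P] or [a] lies in the
    radical of [P] ([wsq_primary_mul]).

    Fix [r]. As [<r>] consists of the multiples of [r] and contains [r], the
    inclusion of [<r>] in [P_r] just says [r . r \in P] ([principal_residual]).
    Hence the wsq-primary condition says that, for every [r], either this
    inclusion holds or [P_r] is covered by the radical of [P] together with
    [A_r]. The theorem asserts that one of these two sets is then enough. They
    are subhypergroups, and so is [P_r]: both [P_r] and [A_r] are residuals by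
    [r], of [P] and of [{0}], and distributivity makes residuals of
    subhypergroups subhypergroups ([residual_subhypergroup]). So it remains to
    see that a subhypergroup covered by two others lies in one of them, as for
    ordinary groups; reversibility of the hyperaddition plays the role of
    subtraction ([subhypergroup_subU]). *)

(** * Subhypergroups *)

Section Subhypergroups.
Variables (m n : nat) (R : krasner_hyperring m.+2 n).
Implicit Types A B C : set R.

(** Membership of [0] is a separate condition because in general it does not
    follow from the other two: the odd integers are closed under ternary sums
    and opposites. *)
Record subhypergroup A : Prop := Subhypergroup {
  subhypergroup0 : A kzero;
  subhypergroup_hadd : forall a : 'I_m.+2 -> R,
    (forall j, A (a j)) -> hadd a `<=` A;
  subhypergroup_opp : forall x, A x -> A (kopp x)
}.

Lemma hadd_kzero : hadd (fun=> kzero) = [set (kzero : R)].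
Proof.
rewrite -(hadd_zero (hadd_canonical R)); congr hadd.
by apply/funext => -[[|[|k]] ?].
Qed.

Lemma kopp0 : kopp kzero = kzero :> R.
Proof.
apply/esym/(hadd_opp_unique (hadd_canonical R)).
have -> : pad kzero [:: kzero; kzero] = (fun=> kzero) :> ('I_m.+2 -> R).
  by apply/funext => -[[|[|[|k]]] ?].
by rewrite hadd_kzero.
Qed.

Lemma subhypergroup_kzero : subhypergroup [set kzero].
Proof.
split=> // [a a0|_ ->]; last exact: kopp0.
by have -> : a = (fun=> kzero); [exact/funext|rewrite hadd_kzero].
Qed.

(** Reversibility expresses [a i] as a term of the sum of [x] and the opposites
    of the other summands. *)
Lemma subhypergroup_cancel A (a : 'I_m.+2 -> R) i x : subhypergroup A ->
  hadd a x -> A x -> (forall j, j != i -> A (a j)) -> A (a i).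
Proof.
move=> sA ax Ax Aa.
apply: (subhypergroup_hadd sA) (hadd_reversible (hadd_canonical R) i ax).
move=> k /=; case: ifPn => // k0; case: ifPn => ki;
  apply: (subhypergroup_opp sA); apply: Aa; rewrite -val_eqE /=.
- case: k k0 ki => -[|k] //= km _ ki.
  by rewrite modnDr modn_small ?(ltnW km)// neq_ltn ki.
- by rewrite neq_ltn orbC ltnNge ki.
Qed.

(** If [x] lay in [A] outside [C] and [y] in [A] outside [B], then [x \in B] and
    [y \in C]; a term [z] of [x + y] belongs to [B] or to [C], and cancelling
    the summand from the same set puts [y] in [B] or [x] in [C]. *)
Lemma subhypergroup_subU A B C :
  subhypergroup A -> subhypergroup B -> subhypergroup C ->
  A `<=` B `|` C -> A `<=` B \/ A `<=` C.
Proof.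
move=> sA sB sC ABC.
have [|/existsNP[y /not_implyP[Ay nBy]]] := pselect (A `<=` B); first by left.
have [|/existsNP[x /not_implyP[Ax nCx]]] := pselect (A `<=` C); first by right.
have Bx : B x by case: (ABC x Ax).
have Cy : C y by case: (ABC y Ay).
pose a : 'I_m.+2 -> R := pad kzero [:: x; y].
have [z az] := hadd_nonempty (hadd_canonical R) a.
have Az : A z.
  apply: (subhypergroup_hadd sA) az => -[[|[|k]] ?] //=.
  by rewrite /a /pad /= nth_nil; exact: subhypergroup0.
have a0 D (k : 'I_m.+2) : subhypergroup D -> 1 < k -> D (a k).
  by case: k => -[|[|k]] //= ? sD _; rewrite /a /pad /= nth_nil;
    exact: subhypergroup0.
case: (ABC z Az) => [Bz|Cz].
- case: nBy; pose i1 : 'I_m.+2 := Ordinal (isT : 1 < m.+2).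
  apply: (subhypergroup_cancel (i := i1) sB az Bz) => k ki.
  by case: (ltnP 1 k) => [/a0|]; [exact|case: k ki => -[|[|k]]].
- case: nCx; apply: (subhypergroup_cancel (i := ord0) sC az Cz) => k ki.
  by case: (ltnP 1 k) => [/a0|]; [exact|case: k ki => -[|[|k]]].
Qed.

End Subhypergroups.

(** * Binary products *)

Section BinaryProducts.
Variables (m n : nat) (R : krasner_hyperring m n.+2) (one : R).
Hypotheses (hR : commutative_hyperring R) (h1 : scalar_identity one).
Implicit Types (x y z : R) (b : 'I_n.+2 -> R).

Local Notation "x ** y" := (gmul (pad one [:: x; y]) : R)
  (at level 40, left associativity).

Lemma mulC x y : x ** y = y ** x.
Proof.
pose i1 : 'I_n.+2 := Ordinal (isT : 1 < n.+2).
rewrite -(hR (tperm ord0 i1)); congr gmul; apply/funext => k.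
by case: tpermP => [->|->|/eqP + /eqP +] //; case: k => -[|[|k]].
Qed.

Lemma mulr1 x : x ** one = x.
Proof.
rewrite -[RHS]h1; congr gmul.
by apply/funext => -[[|[|[|k]]] ?].
Qed.

(** Associativity for the sequence [b, z, 1, ..., 1]: the inner product takes
    all of [b] on the left, and starts at the second entry of [b], hence ends
    with [z], on the right. Commutativity moves this [z] to the front. *)
Lemma gmul_mul0 b z :
  gmul b ** z = b ord0 ** gmul [eta b with ord0 |-> z].
Proof.
pose a k := if k < n.+2 then b (inord k) else nth one [:: z] (k - n.+2).
pose i1 : 'I_n.+2 := Ordinal (isT : 1 < n.+2).
have wa0 : window a 0 = b :> ('I_n.+2 -> R).
  by apply/funext => k; rewrite /window /a add0n ltn_ord inord_val.
have wa1 : gmul (window a 1) = gmul [eta b with ord0 |-> z].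
  have ordSi : injective (@ordS n.+2) by exact: ordS_inj.
  rewrite -[RHS](hR (perm ordSi)); congr gmul; apply/funext => k.
  rewrite permE /window /a add1n /= -val_eqE /=.
  case: ltnP => [kn|nk]; first by rewrite modn_small//=; congr b;
    apply/val_inj; rewrite /= inordK// modn_small.
  have -> : k = n.+1 :> nat by apply/eqP; rewrite eqn_leq -ltnS ltn_ord.
  by rewrite modnn subnn.
have := gmul_assoc a ord0 i1; rewrite wa0 wa1.
set u := nested _ _ _; set v := nested _ _ _.
have -> : u = pad one [:: gmul b; z].
  apply/funext => -[[|k] ?] //=.
  by rewrite /u /nested /a /= ltnNge leq_addl /= addnK.
have -> // : v = pad one [:: b ord0; gmul [eta b with ord0 |-> z]].
apply/funext => -[[|[|k]] ?] //=.
  by rewrite /v /nested /a /=; congr b; apply/val_inj; rewrite /= inordK.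
rewrite /v /nested /a /= ltnNge leq_addl /= addnK.
by rewrite /pad /= !nth_nil.
Qed.

Lemma gmul_mul b i z : gmul b ** z = b i ** gmul [eta b with i |-> z].
Proof.
pose s := tperm ord0 i.
rewrite -(hR s b) gmul_mul0 tpermL -(hR s [eta b with i |-> z]).
congr (_ ** gmul _); apply/funext => k /=.
by rewrite -(inj_eq (@perm_inj _ s) k) tpermL.
Qed.

Lemma gmul_split b i : gmul b = b i ** gmul [eta b with i |-> one].
Proof. by rewrite -gmul_mul mulr1. Qed.

Lemma mulCA x y z : x ** (y ** z) = y ** (x ** z).
Proof.
rewrite -[LHS](mulC _ x) (gmul_mul _ ord0); congr (_ ** gmul _).
by apply/funext => -[[|k] ?].
Qed.

Lemma gmul_distrr r (a : 'I_m -> R) :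
  [set r ** x | x in hadd a] = hadd (fun j => r ** a j).
Proof.
pose i1 : 'I_n.+2 := Ordinal (isT : 1 < n.+2).
have upd x : gmul [eta pad one [:: r; r] with i1 |-> x] = r ** x.
  by congr gmul; apply/funext => -[[|[|k]] ?].
have := gmul_distr i1 (pad one [:: r; r]) a.
under eq_imagel do rewrite upd.
by move=> ->; congr hadd; apply/funext => j; rewrite upd.
Qed.

Lemma mulr0 r : r ** kzero = kzero.
Proof. by rewrite mulC; exact: (gmul_zero (i := ord0)). Qed.

End BinaryProducts.

(** * Residuals and the wsq-primary condition *)

Section Residuals.
Variables (m n : nat) (R : krasner_hyperring m.+2 n.+2) (one : R).
Hypotheses (hR : commutative_hyperring R) (h1 : scalar_identity one).
Implicit Types (A I P : set R) (r x y : R).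

Local Notation "x ** y" := (gmul (pad one [:: x; y]) : R)
  (at level 40, left associativity).

Lemma hyperideal_subhypergroup I : hyperideal I -> subhypergroup I.
Proof.
move=> hI; split; [|exact: hyperideal_hadd|exact: hyperideal_opp].
have [x Ix] := hyperideal_nonempty hI.
rewrite -(gmul_zero (a := pad kzero [:: x]) (i := ord_max)).
  exact: (hyperideal_gmul hI (i := ord0)).
by rewrite /pad /= nth_nil.
Qed.

Lemma radical_subhypergroup P : subhypergroup (radical P).
Proof.
have sQ (Q : set R) : prime_hyperideal Q -> subhypergroup Q.
  by move=> [[+ _] _]; exact: hyperideal_subhypergroup.
split=> [Q [pQ _]|a Pa x ax Q [pQ PQ]|x Px Q [pQ PQ]].
- exact: subhypergroup0 (sQ _ pQ).
- by apply: (subhypergroup_hadd (sQ _ pQ)) ax => j; exact: Pa.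
- by apply: (subhypergroup_opp (sQ _ pQ)); exact: Px.
Qed.

(** Distributivity gives [0 \in r . x + r . (- x)], so that uniqueness of
    opposites applies. *)
Lemma mulrN r x : r ** kopp x = kopp (r ** x).
Proof.
apply: (hadd_opp_unique (hadd_canonical R)).
have -> : pad kzero [:: r ** x; r ** kopp x] =
    (fun j => r ** pad kzero [:: x; kopp x] j) :> ('I_m.+2 -> R).
  by apply/funext => -[[|[|k]] ?] //; rewrite /pad /= !nth_nil mulr0.
rewrite -gmul_distrr; exists kzero; last exact: mulr0.
exact: hadd_opp (hadd_canonical R) x.
Qed.

Lemma residual_subhypergroup A r :
  subhypergroup A -> subhypergroup (residual one A r).
Proof.
move=> sA; split=> [|a Aa x ax|x Ax]; rewrite /residual /=.
- by rewrite mulr0//; exact: subhypergroup0.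
- apply: (subhypergroup_hadd sA Aa).
  by rewrite -gmul_distrr; exists x.
- by rewrite mulrN; exact: subhypergroup_opp.
Qed.

Lemma annihilator_subhypergroup r : subhypergroup (annihilator one r).
Proof.
exact: residual_subhypergroup (subhypergroup_kzero R).
Qed.

(** [r] is itself a multiple of [r], and [r . (s . r) = s . (r . r)]. *)
Lemma principal_residual P r : hyperideal P ->
  principal one r `<=` residual one P r <-> P (r ** r).
Proof.
move=> hP; split=> [sub|Prr _ [s _ <-]].
  by apply: sub; exists one; rewrite // mulC// mulr1.
rewrite /residual /= mulCA// mulC//.
exact: (hyperideal_gmul hP (i := ord0)).
Qed.

(** A binary product [r . a] is the value of [g] at any tuple with [r] at the
    distinguished position [i], [a] at another one, and [1] elsewhere. *)
Lemma wsq_primary_mul P : proper_hyperideal P ->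
  wsq_primary one P <->
  forall r a, r ** a <> kzero -> P (r ** a) -> P (r ** r) \/ radical P a.
Proof.
move=> hP; split=> [[_ [i wP]] r a|wP].
  pose b : 'I_n.+2 -> R := fun k => pad one [:: r; a] (tperm ord0 i k).
  have bi : b i = r by rewrite /b tpermR.
  have gb : gmul b = r ** a by exact: hR.
  have gb1 : gmul [eta b with i |-> one] = a.
    rewrite -[RHS](mulr1 h1) mulC// -(hR (tperm ord0 i)).
    congr gmul; apply/funext => k /=.
    have -> : (tperm ord0 i k == i) = (k == ord0).
      by rewrite -(inj_eq (@perm_inj _ (tperm ord0 i)) k) tpermL.
    by rewrite /b tpermK; case: k => -[].
  by have := wP b; rewrite bi gb gb1.
split=> //; exists ord0 => b b0 Pb.
by apply: wP; rewrite -gmul_split.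
Qed.

End Residuals.

Unset Implicit Arguments.

Theorem theorem4p9 (m n : nat) (hm : 2 <= m) (hn : 2 <= n)
    (R : krasner_hyperring m n) (hR : commutative_hyperring R)
    (one : R) (h1 : scalar_identity one) (h10 : one <> kzero)
    (P : set R) (hP : proper_hyperideal P) :
  wsq_primary one P <->
  forall r : R,
    principal one r `<=` residual one P r \/
    residual one P r `<=` radical P \/
    residual one P r `<=` annihilator one r.
Proof.
case: m hm n hn R hR one h1 h10 P hP => [|[|m]] // _ [|[|n]] // _ R hR one h1 _.
move=> P hP; have hI := hP.1; rewrite wsq_primary_mul//.
split=> [wP r|trichotomy r a ra0 Pra].
  rewrite principal_residual//.
  have [|nPrr] := pselect (P (gmul (pad one [:: r; r]))); first by left.
  right; apply: subhypergroup_subU.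
  - by apply: residual_subhypergroup => //; exact: hyperideal_subhypergroup.
  - exact: radical_subhypergroup.
  - exact: (annihilator_subhypergroup one hR).
  move=> a Pra; have [|ra0] := pselect (annihilator one r a); first by right.
  by left; case: (wP r a ra0 Pra).
have [sub|[sub|sub]] := trichotomy r.
- by left; apply/principal_residual.
- by right; exact: sub.
- by case: ra0; exact: sub.
Qed.
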